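(* For every positive integer $N$ there exists a finite set $P$ of at least $N$ points in the plane such that no 4 points of $P$ are collinear and $P$ contains no visible island of size $13$.
   Context: Let $P$ be a finite point set in the plane. Two points $p,q\in P$ are visible in $P$ if no other point of $P$ lies in the interior of the segment $\overline{pq}$. A subset $S\subseteq P$ is an island in $P$ if $\mathrm{conv}(S)\cap P = S$. A subset $S\subseteq P$ is a visible island in $P$ if $S$ is an island in $P$ and the points of $S$ are pairwise visible in $P$. *)

(* Defs.v *)
From HB Require Import structures.
From mathcomp Require Import all_boot all_order all_algebra finmap.
From mathcomp Require Import mathcomp_extra boolp classical_sets set_interval reals convex.

Set Implicit Arguments.
Unset Strict Implicit.
Unset Printing Implicit Defensive.

Import Order.TTheory GRing.Theory Num.Theory.

Local Open Scope classical_set_scope.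
Local Open Scope ring_scope.

Definition convex_hull (R : realType) (A : set 'rV[R]_2) : set 'rV[R]_2 :=
  smallest (@convex_set R 'rV[R]_2) A.

Definition open_segment (R : realType) (p q : 'rV[R]_2) : set 'rV[R]_2 :=
  [set (1 - t) *: p + t *: q | t in `]0, 1[].

Definition line (R : realType) (p v : 'rV[R]_2) : set 'rV[R]_2 :=
  [set p + t *: v | t in setT].

Definition collinear (R : realType) (A : set 'rV[R]_2) : Prop :=
  exists p v : 'rV[R]_2, v != 0 /\ A `<=` line p v.

(* A point is always visible from itself: [open_segment p p] is [set p]. *)
Definition visible (R : realType) (P : {fset 'rV[R]_2}) (p q : 'rV[R]_2) : Prop :=
  forall r, r \in P -> r != p -> r != q -> ~ open_segment p q r.

Definition island (R : realType) (P S : {fset 'rV[R]_2}) : Prop :=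
  (S `<=` P)%fset /\ convex_hull [set` S] `&` [set` P] = [set` S].

Definition visible_island (R : realType) (P S : {fset 'rV[R]_2}) : Prop :=
  island P S /\ {in S &, forall p q, visible P p q}.

(* Main.v *)
Require Import Defs.
From mathcomp Require Import all_boot all_order all_algebra finmap zify ring lra.
From mathcomp Require Import mathcomp_extra boolp classical_sets set_interval.
From mathcomp Require Import reals interval_inference convex.

Set Implicit Arguments.
Unset Strict Implicit.
Unset Printing Implicit Defensive.

Import Order.TTheory GRing.Theory Num.Theory.

Local Open Scope classical_set_scope.
Local Open Scope ring_scope.

(** Replace every point of a Horton set by three points that are very close to
    each other on a vertical line. Among any seven points of a Horton set there
    are three whose triangle has a point of the set in its interior: this is the
    absence of empty heptagons, stated so as to cover the points that are not in
    convex position. A visible island misses a point of every triple, so one of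
    size 13 meets at least seven triples; some triple then lies in the interior
    of a triangle spanned by the island, hence in the island, a contradiction.

    The Horton set is the graph of a function [f] on [0, 2 ^ k), where even and
    odd indices recursively form Horton sets, one far above the other. *)

(** * Orientation determinants and integer Horton sets *)

(** Twice the signed area of the triangle on the graph of [f] over [i], [j], [k]. For [i < j] it is
    positive when the third point lies above the line through the first two. *)
Definition det (f : nat -> int) (i j k : nat) : int :=
  (j%:Z - i%:Z) * (f k - f i) - (k%:Z - i%:Z) * (f j - f i).

Lemma det_cycle f i j k : det f i j k = det f j k i.
Proof. rewrite /det; ring. Qed.

Lemma det_swap f i j k : det f j i k = - det f i j k.
Proof. rewrite /det; ring. Qed.

Lemma det_opp f i j k : det (fun i => - f i) i j k = - det f i j k.
Proof. rewrite /det; ring. Qed.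

Definition parity_part (b : bool) (f : nat -> int) (i : nat) : int :=
  f (b + i.*2)%N.

Lemma det_parity_part (b : bool) f i j k :
  det f (b + i.*2) (b + j.*2) (b + k.*2) = 2 * det (parity_part b f) i j k.
Proof. by rewrite /det /parity_part -!muln2 !PoszD !PoszM; ring. Qed.

(* [b] is the parity of the indices of the upper points. *)
Definition separated (b : bool) (n : nat) (f : nat -> int) : Prop :=
  forall i j u, (i < j < n)%N -> (u < n)%N -> odd i = odd j -> odd u != odd i ->
  if odd i == b then det f i j u < 0 else 0 < det f i j u.

(** The upper parity may differ from one part to another, which makes the notion stable under
    reflection in the horizontal axis. *)
Fixpoint horton (k : nat) (f : nat -> int) : Prop :=
  if k is k'.+1 then
    (forall b, horton k' (parity_part b f)) /\
    exists b, separated b (2 ^ k) f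
  else True.

Lemma separated_opp b n f :
  separated b n f -> separated (~~ b) n (fun i => - f i).
Proof.
move=> sepf i j u ij un oij oui; have := sepf i j u ij un oij oui.
by rewrite det_opp oppr_lt0 oppr_gt0; case: (odd i) (b) => -[].
Qed.

Lemma horton_opp k f : horton k f -> horton k (fun i => - f i).
Proof.
elim: k f => [//|k IHk] f [hf [b sepf]]; split=> [c|]; first exact: (IHk _ (hf c)).
by exists (~~ b); apply: separated_opp.
Qed.

(** Here [d] and [w] are horizontal differences, [t] and [v] vertical ones: the lift [M] between the
    two classes outweighs the slope of a line within one class. *)
Lemma shift_dominates (d w t v m B M : int) : 1 <= d -> `|w| <= m ->
  `|t| <= B -> `|v| <= B -> B + m * B < M -> 0 < d * (t + M) - w * v.
Proof.
move=> d1 wm tB vB BM.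
have wv : w * v <= m * B.
  by rewrite (le_trans (ler_norm _)) // normrM ler_pM.
have tM : 0 <= t + M by nia.
by have := ler_peMl tM d1; lia.
Qed.

Lemma exists_horton k : exists f, horton k f.
Proof.
(* The height bound [B] is carried through the induction because the next lift depends on it. *)
suff [f [B [hf _]]] : exists f B, horton k f /\
    forall i, (i < 2 ^ k)%N -> 0 <= f i <= B%:Z by exists f.
elim: k => [|k [f [B [hf fB]]]]; first by exists (fun=> 0), 0%N.
(* [M] exceeds [B + 2 * n * B], as [shift_dominates] requires for horizontal differences up to
   [2 * n]. *)
pose n := (2 ^ k)%N; pose M : int := (4 * n * B.+1)%N%:Z.
pose g i := f i./2 + (if odd i then M else 0).
have n0 : (0 < n)%N by rewrite expn_gt0.
have n2 : (2 ^ k.+1 = 2 * n)%N by rewrite expnS.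
have gpart b i : parity_part b g i = f i + (if b then M else 0).
  rewrite /parity_part /g oddD odd_double addbF half_bit_double.
  by case: b.
(* The parts of [g] are vertical translates of [f], and [det] ignores such translations. *)
have hpart h : (exists c, forall i, h i = f i + c) -> horton k h.
  case=> c; move: (k) f h hf {fB gpart g}.
  elim=> [//|k' IH] f h [hf [b sepf]] hE; split=> [c'|].
    by apply: IH (hf c') _ => i; exact: hE.
  exists b => i j u ij un oij oui.
  have -> : det h i j u = det f i j u by rewrite /det !hE; ring.
  exact: sepf.
exists g, (B + 4 * n * B.+1)%N; split; last first.
  move=> i; rewrite n2 => i2n; rewrite /g.
  have /fB : (i./2 < 2 ^ k)%N by rewrite ltn_half_double -mul2n.
  by case: (odd i); rewrite /M; lia.
split=> [b|].
  by apply: hpart; exists (if b then M else 0) => i; rewrite gpart.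
exists true => i j u; rewrite n2 => /andP[ij jn] un oij oui.
have half_lt m : (m < 2 * n)%N -> (m./2 < 2 ^ k)%N by rewrite ltn_half_double -mul2n.
have := fB _ (half_lt _ un); have := fB _ (half_lt _ jn).
have := fB _ (half_lt _ (ltn_trans ij jn)).
rewrite /det /g -oij; set x := f i./2; set y := f j./2; set z := f u./2.
move=> hx hy hz; move: oui; case: (odd i); case: (odd u) => //= _.
  rewrite -oppr_gt0 [ltRHS](_ : _ = (j%:Z - i%:Z) * (x - z + M) -
    (u%:Z - i%:Z) * (x - y)); last by ring.
  by apply: (@shift_dominates _ _ _ _ (2 * n%:Z) B%:Z); rewrite /M;
    clear -hx hy hz ij jn un n0; nia.
rewrite [ltRHS](_ : _ = (j%:Z - i%:Z) * (z - x + M) -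
  (u%:Z - i%:Z) * (y - x)); last by ring.
by apply: (@shift_dominates _ _ _ _ (2 * n%:Z) B%:Z); rewrite /M;
  clear -hx hy hz ij jn un n0; nia.
Qed.

(** * General position and points inside triangles *)

Lemma parity_half (b : bool) i : odd i = b -> i = (b + i./2.*2)%N.
Proof. by move=> <-; rewrite odd_double_half. Qed.

Lemma separated_noncollinear b n f i j u : separated b n f ->
  (i < n)%N -> (j < n)%N -> (u < n)%N -> i != j -> odd i = odd j ->
  odd u != odd i -> det f i j u != 0.
Proof.
move=> sepf; wlog ij : i j / (i < j)%N => [hwlog|].
  move=> i_n j_n un; rewrite neq_ltn => /orP[] ij oij oui.
    by apply: hwlog => //; rewrite ltn_eqF.
  by rewrite det_swap oppr_eq0; apply: hwlog => //; [rewrite ltn_eqF|rewrite -oij].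
move=> _ jn un _ oij oui; have := sepf i j u; rewrite ij jn un => /(_ isT isT oij oui).
by case: ifP => _; [apply: ltr0_neq0|apply: lt0r_neq0].
Qed.

(** Three indices of one parity reduce to their halves, one level down. Otherwise exactly two share
    a parity, and separation keeps the third point off their line. *)
Lemma horton_noncollinear k f i j l : horton k f ->
  (i < 2 ^ k)%N -> (j < 2 ^ k)%N -> (l < 2 ^ k)%N ->
  i != j -> j != l -> l != i -> det f i j l != 0.
Proof.
elim: k f i j l => [|k IHk] f i j l /=.
  by move=> _; rewrite expn0 !ltnS !leqn0 => /eqP-> /eqP->.
move=> [hf [b sepf]] ik jk lk ij jl li.
have [oij|oij] := eqVneq (odd i) (odd j); last first.
  have [ojl|ojl] := eqVneq (odd j) (odd l).
    by rewrite det_cycle; apply: separated_noncollinear sepf _ _ _ _ _ _.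
  rewrite -det_cycle; apply: separated_noncollinear sepf _ _ _ _ _ _ => //.
  by move: oij ojl; do 3!case: (odd _).
have [oli|oli] := eqVneq (odd l) (odd i); last first.
  exact: separated_noncollinear sepf _ _ _ _ _ _.
rewrite expnS in ik jk lk.
rewrite (parity_half (erefl (odd i))) (parity_half (esym oij)) (parity_half oli).
rewrite det_parity_part mulf_neq0 //; apply: IHk; first exact: hf.
all: lia.
Qed.

(* If two of the four points are low, an upper point lies between them. If
   only one is, then two of the upper ones are on the same side of it and the
   nearer of these is above the segment joining the other two points. *)
Lemma horton_four_above k f a b c d : horton k f ->
  (a < b)%N -> (b < c)%N -> (c < d)%N -> (d < 2 ^ k)%N ->
  exists p q r, [/\ p \in [:: a; b; c; d], q \in [:: a; b; c; d],
    (p < r < q)%N, (r < 2 ^ k)%N & 0 < det f p q r].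
Proof.
elim: k f a b c d => [|k IHk] f a b c d /=; first by lia.
move=> [hf [up sepf]] ab bc cd dk.
have two_low p q : p \in [:: a; b; c; d] -> q \in [:: a; b; c; d] ->
    (p < q < 2 ^ k.+1)%N -> odd p = ~~ up -> odd q = ~~ up ->
    exists p q r, [/\ p \in [:: a; b; c; d], q \in [:: a; b; c; d],
      (p < r < q)%N, (r < 2 ^ k.+1)%N & 0 < det f p q r].
  (* [p.+1] has the upper parity, so it is not [q] and its point is above the segment. *)
  move=> pin qin /andP[pq qk] op oq; exists p, q, p.+1.
  have p1q : (p.+1 < q)%N.
    by rewrite ltn_neqAle pq andbT; apply/eqP=> E; move: oq; rewrite -E /= op; case: (up).
  split=> //; [lia|lia|].
  have := sepf p q p.+1; rewrite pq qk (ltn_trans p1q qk) op oq /= op.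
  by case: (up) => /(_ isT isT erefl isT).
have two_high p q r : p \in [:: a; b; c; d] -> r \in [:: a; b; c; d] ->
    (p < q < r)%N -> (r < 2 ^ k.+1)%N ->
    odd q = up -> (odd p = up /\ odd r = ~~ up) \/ (odd p = ~~ up /\ odd r = up) ->
    exists p q r, [/\ p \in [:: a; b; c; d], q \in [:: a; b; c; d],
      (p < r < q)%N, (r < 2 ^ k.+1)%N & 0 < det f p q r].
  move=> pin rin /andP[pq qr] rk oq opr; exists p, r, q; split=> //; [lia|lia|].
  rewrite det_cycle det_swap oppr_gt0.
  case: opr => -[op or].
    have := sepf p q r; rewrite pq (ltn_trans qr rk) rk op oq or.
    rewrite [det f p q r]det_cycle eqxx.
    by case: (up) => /(_ isT isT erefl isT).
  have := sepf q r p; rewrite qr rk (ltn_trans pq (ltn_trans qr rk)) op oq or.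
  rewrite eqxx.
  by case: (up) => /(_ isT isT erefl isT).
have bk : (b < 2 ^ k.+1)%N by lia.
have ck : (c < 2 ^ k.+1)%N by lia.
have [[e [oa ob oc od]]|nsame] :=
  pselect (exists e, [/\ odd a = e, odd b = e, odd c = e & odd d = e]).
  rewrite expnS in dk.
  have [||||p [q [r [pin qin prq rk pqr]]]] :=
    IHk _ a./2 b./2 c./2 d./2 (hf e); try lia.
  have lift x : x \in [:: a./2; b./2; c./2; d./2] -> (e + x.*2)%N \in [:: a; b; c; d].
    rewrite !inE => /or4P[] /eqP->; rewrite -parity_half // eqxx ?orbT //.
  exists (e + p.*2)%N, (e + q.*2)%N, (e + r.*2)%N; split; try exact: lift.
  - by lia.
  - by rewrite expnS; case: (e); lia.
  - by rewrite det_parity_part pmulr_rgt0.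
have mem4 : [/\ a \in [:: a; b; c; d], b \in [:: a; b; c; d],
   c \in [:: a; b; c; d] & d \in [:: a; b; c; d]] by rewrite !inE !eqxx !orbT.
case: mem4 => ma mb mc md.
have low x : odd x != up -> odd x = ~~ up by case: (odd x) (up) => -[].
(* Of the sixteen parity patterns, the constant ones contradict [nsame]; the others have at least
   two low points or exactly one. *)
have [oa|/low oa] := eqVneq (odd a) up; have [ob|/low ob] := eqVneq (odd b) up;
have [oc|/low oc] := eqVneq (odd c) up; have [od|/low od] := eqVneq (odd d) up;
first [ by case: nsame; exists up | by case: nsame; exists (~~ up)
  | by apply: (two_low a b); rewrite // ab
  | by apply: (two_low a c); rewrite // (ltn_trans ab bc)
  | by apply: (two_low a d); rewrite // dk andbT; lia
  | by apply: (two_low b c); rewrite // bc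
  | by apply: (two_low b d); rewrite // dk andbT; lia
  | by apply: (two_low c d); rewrite // cd
  | by apply: (two_high a b c) => //; [rewrite ab|left]
  | by apply: (two_high a b d) => //; [lia|left]
  | by apply: (two_high b c d) => //; [rewrite bc|right]
  | by apply: (two_high a c d) => //; [lia|right] ].
Qed.

Lemma four_increasing (s : seq nat) : uniq s -> (4 <= size s)%N ->
  exists a b c d, [/\ (a < b)%N, (b < c)%N, (c < d)%N & {subset [:: a; b; c; d] <= s}].
Proof.
move=> us; rewrite -(size_sort leq).
have : sorted ltn (sort leq s).
  by rewrite ltn_sorted_uniq_leq sort_uniq us sort_sorted //; apply: leq_total.
have := mem_sort leq s; case: (sort leq s) => [|a [|b [|c [|d t]]]] //= mems.
move=> /and4P[ab bc cd _] _; exists a, b, c, d; split=> // x xin.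
by rewrite -mems; move: xin; rewrite !inE => /or4P[] ->; rewrite ?orbT.
Qed.

(** Strict interior of a counterclockwise triangle. Reflection reverses orientation, whence the swap
    in [inside_opp]. *)
Definition inside f a b c r := [/\ 0 < det f a b r, 0 < det f b c r & 0 < det f c a r].

Lemma inside_opp f a b c r : inside (fun i => - f i) a b c r -> inside f b a c r.
Proof.
rewrite /inside !det_opp => -[ab bc ca].
by split; rewrite det_swap.
Qed.

(* Say four of the seven points are low and [u] is a high one. If [r] is a low
   point above the segment [p q] joining two of the four, then [u] is above the
   lines [p r] and [r q], so [r] is inside the triangle [p q u]. *)
Lemma horton_seven_inside k f (s : seq nat) : horton k f -> uniq s ->
  {in s, forall i, (i < 2 ^ k)%N} -> (7 <= size s)%N ->
  exists a b c r, [/\ a \in s, b \in s, c \in s, (r < 2 ^ k)%N & inside f a b c r].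
Proof.
elim: k f s => [|k IHk] f s hf us sk s7.
  have /(uniq_leq_size us) : {subset s <= [:: 0%N]}.
    by move=> i /sk; rewrite expn0 ltnS leqn0 inE.
  by move=> /(leq_trans s7).
pose t e := [seq i <- s | odd i == e].
have ut e : uniq (t e) by rewrite filter_uniq.
have szt e : (size (t e) + size (t (~~ e)) = size s)%N.
  rewrite !size_filter -(count_predC (fun i => odd i == e) s); congr (_ + _)%N.
  by apply: eq_count => i /=; case: (odd i) (e) => -[].
have tP e i : i \in t e -> i \in s /\ odd i = e.
  by rewrite mem_filter => /andP[/eqP].
have [hpart [b sepf]] := hf.
pose h e := [seq i./2 | i <- t e].
have uh e : uniq (h e).
  rewrite map_inj_in_uniq // => i j /tP[_ oi] /tP[_ oj] ij.
  by rewrite (parity_half oi) (parity_half oj) ij.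
have hP e i : i \in h e -> (e + i.*2)%N \in t e.
  by move=> /mapP[j /[dup] jt /tP[_ oj] ->]; rewrite -parity_half.
have hk e : {in h e, forall i, (i < 2 ^ k)%N}.
  by move=> i /hP /tP[/sk + _]; rewrite expnS; lia.
(* If all points share a parity, the induction hypothesis applies to that part. *)
have [[e te]|tn0] := pselect (exists e, size (t e) = 0%N).
  have [] := IHk _ (h (~~ e)) (hpart (~~ e)) (uh _) (@hk _).
    by have := szt e; rewrite te add0n size_map => ->.
  move=> p [q [u [r [/hP/tP[ps _] /hP/tP[qs _] /hP/tP[us' _] rk [pq qu up]]]]].
  exists (~~ e + p.*2)%N, (~~ e + q.*2)%N, (~~ e + u.*2)%N, (~~ e + r.*2)%N.
  split=> //; first by rewrite expnS; case: (e); lia.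
  by split; rewrite det_parity_part pmulr_rgt0.
(* Pigeonhole: some parity class contains four of the seven points. *)
have [e te4] : exists e, (4 <= size (t e))%N.
  have /= := szt true; have [|lt4] := leqP 4 (size (t true)); first by exists true.
  by exists false; lia.
have [u ute] : exists u, u \in t (~~ e).
  case E : (t (~~ e)) => [|u t']; last by exists u; rewrite inE eqxx.
  by case: tn0; exists (~~ e); rewrite E.
have {ute} [us' ou] := tP _ _ ute.
have size_h : (4 <= size (h e))%N by rewrite size_map.
have {uh size_h} [a [a' [c [d [aa' a'c cd sub]]]]] := four_increasing (uh e) size_h.
clear -hf hpart sepf aa' a'c cd sub us' ou hP tP hk sk us.
(* Up to reflection, this class is the lower one. *)
wlog eb : f b hf hpart sepf / e != b => [hwlog|].
  have [|] := eqVneq e b; last by move=> /hwlog; apply.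
  have hf' := horton_opp hf.
  have [hpart' _] := hf'.
  move=> eb; have [] := hwlog _ (~~ b) hf' hpart' (separated_opp sepf).
    by rewrite eb; case: (b).
  move=> p [q [v [r [ps qs vs rk /inside_opp pqr]]]].
  by exists q, p, v, r.
have dk : (d < 2 ^ k)%N by apply: (hk e); apply: sub; rewrite !inE eqxx !orbT.
have [p [q [r [/sub/hP/tP[ps op] /sub/hP/tP[qs oq] prq rk pqr]]]] :=
  horton_four_above (hpart e) aa' a'c cd dk.
have e1 : (e <= 1)%N by case: (e).
have or : odd (e + r.*2) = e by rewrite oddD odd_double addbF; case: (e).
have uk := sk _ us'; have qk := sk _ qs.
exists (e + p.*2)%N, (e + q.*2)%N, u, (e + r.*2)%N.
split=> //; first by rewrite expnS; lia.
have above i j : odd i = e -> odd j = e -> (i < j < 2 ^ k.+1)%N -> 0 < det f i j u.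
  move=> oi oj ijk; have := sepf i j u ijk uk; rewrite oi oj ou (negbTE eb).
  by case: (e) => /(_ erefl isT).
split.
- by rewrite det_parity_part pmulr_rgt0.
- by rewrite -det_cycle; apply: above => //; lia.
- by rewrite det_cycle; apply: above => //; lia.
Qed.

(** * Points of the plane and convex hulls *)

Section Plane.
Variable R : realType.
Implicit Types (p q r : 'rV[R]_2) (f : nat -> int).

Definition pdet p q r : R :=
  (q 0 0 - p 0 0) * (r 0 1 - p 0 1) - (r 0 0 - p 0 0) * (q 0 1 - p 0 1).

Lemma row2P p q : p 0 0 = q 0 0 -> p 0 1 = q 0 1 -> p = q.
Proof.
move=> p0 p1; apply/rowP => i; have [->//|i1] : i = 0 \/ i = 1.
  by case: i => [[|[]]] // lt; [left|right]; apply: val_inj.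
by rewrite i1.
Qed.

Lemma convex_set_comb (A : set 'rV[R]_2) p q (t : R) :
  @convex_set R 'rV[R]_2 A -> A p -> A q -> 0 <= t -> t <= 1 ->
  A (t *: p + (1 - t) *: q).
Proof.
move=> cA Ap Aq t0 t1; apply: set_mem.
by apply: (cA p q (Itv01 t0 t1)); apply: mem_set.
Qed.

(** Convexity concerns two points at a time, so [r] is reached from a point of the segment [a b] by
    moving towards [c]. *)
Lemma triangle_sub_convex_hull (A : set 'rV[R]_2) a b c r : A a -> A b -> A c ->
  0 < pdet a b r -> 0 < pdet b c r -> 0 < pdet c a r -> convex_hull A r.
Proof.
move=> Aa Ab Ac; set z := pdet a b r; set x := pdet b c r; set y := pdet c a r.
move=> z0 x0 y0 C [cC AC].
have xy0 : 0 < x + y by lra.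
have xyz0 : 0 < x + y + z by lra.
(* Barycentric coordinates are ratios of areas. *)
have -> : r = ((x + y) / (x + y + z)) *: ((x / (x + y)) *: a + (1 - x / (x + y)) *: b)
    + (1 - (x + y) / (x + y + z)) *: c.
  have xyE : x + y + z != 0 by rewrite gt_eqF.
  have xyE' : x + y != 0 by rewrite gt_eqF.
  have comb i : r 0 i * (x + y + z) = x * a 0 i + y * b 0 i + z * c 0 i ->
     r 0 i = (((x + y) / (x + y + z)) *: ((x / (x + y)) *: a + (1 - x / (x + y)) *: b)
    + (1 - (x + y) / (x + y + z)) *: c) 0 i.
    rewrite !mxE => E; apply: (mulIf xyE); rewrite E; field; exact/andP.
  by apply: row2P; apply: comb; rewrite /x /y /z /pdet; ring.
have ratio (s t : R) : 0 < s -> 0 < t -> 0 <= s / (s + t) /\ s / (s + t) <= 1.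
  by move=> s0 t0; split; [apply: divr_ge0; lra|rewrite ler_pdivrMr; lra].
have [s0 s1] := ratio _ _ x0 y0; have [t0 t1] := ratio _ _ xy0 z0.
apply: convex_set_comb => //; last exact: AC.
by apply: convex_set_comb => //; exact: AC.
Qed.

(** * The tripled Horton set *)

(** Instead of shrinking the triples, heights are stretched, so that all coordinates stay integers;
    [e] numbers the copies. *)
Definition pt f (n i e : nat) : 'rV[R]_2 :=
  \row_j (if j == 0 then i%:R else ((4 * n)%:Z * f i + e%:Z)%:~R).

Lemma pt0 f n i e : pt f n i e 0 0 = i%:R.
Proof. by rewrite mxE. Qed.

Lemma pt1 f n i e : pt f n i e 0 1 = ((4 * n)%:Z * f i + e%:Z)%:~R.
Proof. by rewrite mxE. Qed.

Lemma pt_inj f n i e i' e' : pt f n i e = pt f n i' e' -> i = i' /\ e = e'.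
Proof.
move=> E; have /eqP := congr1 (fun p => p 0 0) E; rewrite !pt0 eqr_nat => /eqP ii.
have /eqP := congr1 (fun p => p 0 1) E; rewrite !pt1 eqr_int ii => /eqP/addrI.
by case=> ->.
Qed.

(* A nonzero integer determinant is at least 1 in absolute value, so scaling
   by [4 * n] leaves room for the vertical shifts. *)
Lemma pdet_pt_gt0 f n i j l e1 e2 e3 :
  (i < n)%N -> (j < n)%N -> (l < n)%N -> (e1 < 3)%N -> (e2 < 3)%N -> (e3 < 3)%N ->
  0 < det f i j l -> 0 < pdet (pt f n i e1) (pt f n j e2) (pt f n l e3).
Proof.
move=> i_n j_n l_n e13 e23 e33 d0; rewrite /pdet !pt0 !pt1.
rewrite !pmulrn -!(intrB, intrM) ltr0z.
have -> : (j%:Z - i%:Z) * ((4 * n)%:Z * f l + e3%:Z - ((4 * n)%:Z * f i + e1%:Z)) -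
    (l%:Z - i%:Z) * ((4 * n)%:Z * f j + e2%:Z - ((4 * n)%:Z * f i + e1%:Z)) =
  (4 * n)%:Z * det f i j l +
    ((j%:Z - i%:Z) * (e3%:Z - e1%:Z) - (l%:Z - i%:Z) * (e2%:Z - e1%:Z)).
  by rewrite /det; ring.
(* The vertical shifts contribute two products, each below [2 * n] in absolute value, hence less
   than [4 * n] in total. *)
have bound (u v : int) : `|u| < n%:Z -> `|v| <= 2 -> `|u * v| < 2 * n%:Z by nia.
have := bound (j%:Z - i%:Z) (e3%:Z - e1%:Z); have := bound (l%:Z - i%:Z) (e2%:Z - e1%:Z).
move: (_ * _) (_ * (e3%:Z - _)) => u v.
move=> /(_ ltac:(lia) ltac:(lia)) hu /(_ ltac:(lia) ltac:(lia)) hv.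
have : (4 * n)%:Z * 1 <= (4 * n)%:Z * det f i j l by rewrite ler_wpM2l.
lia.
Qed.

Lemma pdet_pt_neq0 f n i j l e1 e2 e3 :
  (i < n)%N -> (j < n)%N -> (l < n)%N -> (e1 < 3)%N -> (e2 < 3)%N -> (e3 < 3)%N ->
  det f i j l != 0 -> pdet (pt f n i e1) (pt f n j e2) (pt f n l e3) != 0.
Proof.
move=> i_n j_n l_n e13 e23 e33; rewrite neq_lt => /orP[d0|d0]; last first.
  by rewrite gt_eqF // pdet_pt_gt0.
rewrite -oppr_eq0 (_ : - _ = pdet (pt f n j e2) (pt f n i e1) (pt f n l e3)).
  by rewrite gt_eqF // pdet_pt_gt0 // det_swap oppr_gt0.
rewrite /pdet; ring.
Qed.

Lemma pdet_line p v a b c : line p v a -> line p v b -> line p v c -> pdet a b c = 0.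
Proof.
by move=> [s _ <-] [t _ <-] [u _ <-]; rewrite /pdet !mxE; ring.
Qed.

Definition tripled f n : {fset 'rV[R]_2} :=
  [fset p in [seq pt f n i e | i <- iota 0 n, e <- iota 0 3]]%fset.

Lemma tripledP f n p :
  reflect (exists i e, [/\ (i < n)%N, (e < 3)%N & p = pt f n i e]) (p \in tripled f n).
Proof.
rewrite inE; apply: (iffP allpairsP) => [[[i e] []]|[i [e [i_n e3 ->]]]].
  by rewrite !mem_iota => /andP[_ ?] /andP[_ ?] ->; exists i, e.
by exists (i, e); split; rewrite ?mem_iota.
Qed.

Lemma card_tripled f n : #|` tripled f n| = (n * 3)%N.
Proof.
rewrite card_fseq undup_id ?size_allpairs ?size_iota //.
apply: allpairs_uniq; rewrite ?iota_uniq // => -[i e] [i' e'] _ _ /=.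
by move=> /pt_inj[-> ->].
Qed.

(** A vertical line meets only one triple. On any other line abscissae are distinct, so three points
    would come from three collinear points of the Horton set. *)
Lemma tripled_no_four_collinear k f (A : {fset 'rV[R]_2}) : horton k f ->
  (A `<=` tripled f (2 ^ k))%fset -> #|` A| = 4%N -> ~ collinear [set` A].
Proof.
set n := (2 ^ k)%N => hf /fsubsetP AP A4 [p [v [v0 Av]]].
have [v00|v00] := eqVneq (v 0 0) 0.
  have Ax a : a \in A -> a 0 0 = p 0 0.
    by move=> /Av[t _ <-]; rewrite !mxE v00 mulr0 addr0.
  have [a0 a0A] : exists a, a \in A by apply/fset0Pn; rewrite -cardfs_gt0 A4.
  have /tripledP[i [e0 [_ _ a0E]]] := AP _ a0A.
  have sub : {subset enum_fset A <= [seq pt f n i e | e <- iota 0 3]}.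
    move=> a aA; have /tripledP[j [e [_ e3 aE]]] := AP _ aA.
    have := Ax _ aA; rewrite -(Ax _ a0A) aE a0E !pt0 => /eqP.
    by rewrite eqr_nat => /eqP->; apply: map_f; rewrite mem_iota.
  have := uniq_leq_size (fset_uniq A) sub; rewrite size_map size_iota.
  by rewrite [size _]A4.
have inj a b : a \in A -> b \in A -> a 0 0 = b 0 0 -> a = b.
  move=> /Av[s _ <-] /Av[t _ <-]; rewrite !mxE => /addrI/(mulIf v00) ->.
  by [].
have : uniq A by exact: fset_uniq.
have sizeA : size A = 4%N by [].
have mem x : x \in enum_fset A -> x \in A by [].
case: (enum_fset A) sizeA mem => [|a [|b [|c t]]] //= _ mem.
move=> /and4P[]; rewrite !inE !negb_or => /andP[ab /andP[ac _]] /andP[bc _] _ _.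
have [aA bA cA] : [/\ a \in A, b \in A & c \in A].
  by split; apply: mem; rewrite !inE eqxx ?orbT.
have /tripledP[i [e1 [i_n e13 aE]]] := AP _ aA.
have /tripledP[j [e2 [j_n e23 bE]]] := AP _ bA.
have /tripledP[l [e3 [l_n e33 cE]]] := AP _ cA.
have := pdet_line (Av _ aA) (Av _ bA) (Av _ cA).
apply/eqP; rewrite aE bE cE; apply: pdet_pt_neq0 => //.
apply: horton_noncollinear hf i_n j_n l_n _ _ _.
- by apply: contra_neq ab => ij; apply: inj => //; rewrite aE bE !pt0 ij.
- by apply: contra_neq bc => ij; apply: inj => //; rewrite bE cE !pt0 ij.
- by apply: contra_neq ac => ij; apply: inj => //; rewrite aE cE !pt0 ij.
Qed.

(** * Visible islands of the tripled set *)

(** The middle copy is the midpoint of the outer two and blocks their view. *)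
Lemma visible_island_missing f n (S : {fset 'rV[R]_2}) i :
  visible_island (tripled f n) S -> (i < n)%N ->
  exists2 e, (e < 3)%N & pt f n i e \notin S.
Proof.
move=> -[[SP _] vis] i_n; apply: contrapT => none.
have all3 e : (e < 3)%N -> pt f n i e \in S.
  by move=> e3; apply: contrapT => /negP eS; apply: none; exists e.
have := vis _ _ (all3 0%N isT) (all3 2%N isT) (pt f n i 1).
case; first by apply/tripledP; exists i, 1%N.
- by apply/eqP => /pt_inj[].
- by apply/eqP => /pt_inj[].
- exists (1 / 2) => /=; first by rewrite in_itv /=; lra.
  by apply: row2P; rewrite !mxE /= ?intrD; lra.
Qed.

Lemma tripled_no_visible_island k f (S : {fset 'rV[R]_2}) : horton k f ->
  #|` S| = 13%N -> ~ visible_island (tripled f (2 ^ k)) S.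
Proof.
set n := (2 ^ k)%N => hf S13 visS; have [[/fsubsetP SP hullS] _] := visS.
have /choice[m mP] : forall i, exists e,
    (i < n)%N -> (e < 3)%N /\ pt f n i e \notin S.
  move=> i; have [i_n|_] := boolP (i < n)%N; last by exists 0%N.
  by have [e] := visible_island_missing visS i_n; exists e.
pose s := [seq i <- iota 0 n | has (fun e => pt f n i e \in S) (iota 0 3)].
have sn : {in s, forall i, (i < n)%N}.
  by move=> i; rewrite mem_filter mem_iota => /andP[_ /andP[]].
(* Each triple met by [S] contributes at most two points, so 13 points need at least seven
   triples. *)
have sub : {subset enum_fset S <= [seq pt f n i e | i <- s, e <- rem (m i) (iota 0 3)]}.
  move=> x xS; have /tripledP[i [e [i_n e3 xE]]] := SP _ xS.
  apply/allpairsPdep; exists i, e; split=> //.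
    rewrite mem_filter mem_iota i_n; apply/andP; split=> //.
    by apply/hasP; exists e; rewrite ?mem_iota -?xE.
  rewrite mem_rem_uniq ?iota_uniq // inE mem_iota e3.
  apply/andP; split=> //=.
  by apply: contraNneq (proj2 (mP _ i_n)) => <-; rewrite -xE.
have s7 : (7 <= size s)%N.
  have := uniq_leq_size (fset_uniq S) sub.
  rewrite size_allpairs_dep [size _]S13.
  have -> : [seq size (rem (m i) (iota 0 3)) | i <- s] = nseq (size s) 2%N.
    elim: (s) sn => //= i t IHt sn; rewrite IHt => [|j jt]; last first.
      by apply: sn; rewrite inE jt orbT.
    have [mi3 _] := mP _ (sn i (mem_head _ _)).
    by case: (m i) mi3 => [|[|[]]].
  by rewrite sumn_nseq; lia.
have us : uniq s by rewrite filter_uniq ?iota_uniq.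
have sS i : i \in s -> exists2 e, (e < 3)%N & pt f n i e \in S.
  rewrite mem_filter => /andP[/hasP[e]]; rewrite mem_iota => /andP[_ e3] eS _.
  by exists e.
have [a [b [c [r [as_ bs cs rn [ab bc ca]]]]]] := horton_seven_inside hf us sn s7.
have [mr3] := mP r rn; apply/negP; rewrite negbK.
have [ea ea3 aS] := sS a as_; have [eb eb3 bS] := sS b bs; have [ec ec3 cS] := sS c cs.
have an := sn _ as_; have bn := sn _ bs; have cn := sn _ cs.
(* The copy of [r] absent from [S] lies in a triangle spanned by [S], whichever copies are
   involved. *)
suff : [set` S] (pt f n r (m r)) by [].
rewrite -hullS; split; last by apply/tripledP; exists r, (m r).
by apply: (triangle_sub_convex_hull aS bS cS); exact: pdet_pt_gt0.
Qed.

End Plane.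

Theorem theorem1p2 (R : realType) (N : nat) (N_gt0 : (0 < N)%N) :
  exists P : {fset 'rV[R]_2},
    [/\ (N <= #|` P|)%N,
        forall A : {fset 'rV[R]_2},
          (A `<=` P)%fset -> #|` A| = 4%N -> ~ collinear [set` A] &
        forall S : {fset 'rV[R]_2}, #|` S| = 13%N -> ~ visible_island P S].
Proof.
have [f hf] := exists_horton N; exists (tripled R f (2 ^ N)); split.
- by rewrite card_tripled (leq_trans (ltnW (ltn_expl N (ltnSn 1)))) ?leq_pmulr.
- by move=> A; apply: tripled_no_four_collinear.
- by move=> S; apply: tripled_no_visible_island.
Qed.
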